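(* Let $Q(\cdot)$ be a generalized Moufang loop with respect to a mapping $\alpha$ of $Q$ onto itself, with universal $\alpha$-elasticity, and let $y\in Q$. Then: (i) $y^{\alpha}\in N_{\rho}$ if and only if $y\in N_{\lambda}$; (ii) if $y$ is a generalized Moufang element of the loop $Q(\cdot)$, then $y\in N_{\mu}$ if and only if $y^{\alpha}\in N_{\rho}$.
   Context: A loop $(Q,\cdot)$ is a quasigroup with a two-sided identity element; $b\backslash a$ denotes the unique $u$ with $b\cdot u=a$, and $a/b$ the unique $v$ with $v\cdot b=a$. For a mapping $\alpha$ of $Q$ onto itself, $y^{\alpha}$ denotes the image of $y$ under $\alpha$. A loop $Q$ is a generalized Moufang loop (with respect to $\alpha$) if $((x\cdot y)\cdot z)\cdot y^{\alpha}=x\cdot(y\cdot(z\cdot y^{\alpha}))$ for all $x,y,z\in Q$. An element $y\in Q$ is a generalized Moufang element if $((x\cdot y)\cdot z)\cdot y^{\alpha}=x\cdot(y\cdot(z\cdot y^{\alpha}))$ for all $x,z\in Q$. The $\alpha$-elasticity identity is $(y\cdot z)\cdot y^{\alpha}=y\cdot(z\cdot y^{\alpha})$ for all $y,z\in Q$. The principal isotopes of $(Q,\cdot)$ are the loops $(Q,\circ)$ with $x\circ y=(x/a)\cdot(b\backslash y)$, for $a,b\in Q$. $Q$ has universal $\alpha$-elasticity if the $\alpha$-elasticity identity (with the same map $\alpha$ on the set $Q$) holds in $(Q,\cdot)$ and in each of its principal isotopes. The left, middle and right nuclei are $N_\lambda=\{x\in Q: x\cdot(y\cdot z)=(x\cdot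 y)\cdot z\ \forall y,z\in Q\}$, $N_\mu=\{y\in Q: x\cdot(y\cdot z)=(x\cdot y)\cdot z\ \forall x,z\in Q\}$, $N_\rho=\{z\in Q: x\cdot(y\cdot z)=(x\cdot y)\cdot z\ \forall x,y\in Q\}$. *)

(* Defs.v *)
From Stdlib Require Export FinFun.

(* A loop structure on the fixed set [Q]. [ldiv b a] is [b \ a], the unique
   solution [u] of [b u = a]; [rdiv a b] is [a / b], the unique solution [v]
   of [v b = a]. The equivalences state existence and uniqueness together. *)
Record loop (Q : Type) := Loop {
  mul : Q -> Q -> Q;
  ldiv : Q -> Q -> Q;
  rdiv : Q -> Q -> Q;
  one : Q;
  ldivP : forall a b u : Q, mul b u = a <-> u = ldiv b a;
  rdivP : forall a b v : Q, mul v b = a <-> v = rdiv a b;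
  mul_1_l : forall x : Q, mul one x = x;
  mul_1_r : forall x : Q, mul x one = x
}.

Arguments mul {Q} _ _ _.
Arguments ldiv {Q} _ _ _.
Arguments rdiv {Q} _ _ _.
Arguments one {Q} _.
Arguments ldivP {Q} _ _ _ _.
Arguments rdivP {Q} _ _ _ _.
Arguments mul_1_l {Q} _ _.
Arguments mul_1_r {Q} _ _.

Notation "x *[ L ] y" := (mul L x y)
  (at level 40, L at level 200, left associativity, format "x  *[ L ]  y").

Section PrincipalIsotope.

Context {Q : Type} (L : loop Q) (a b : Q).

Definition isotope_mul (x y : Q) : Q := rdiv L x a *[L] ldiv L b y.
Definition isotope_ldiv (x c : Q) : Q := b *[L] ldiv L (rdiv L x a) c.
Definition isotope_rdiv (c y : Q) : Q := rdiv L c (ldiv L b y) *[L] a.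
Definition isotope_one : Q := b *[L] a.

Lemma isotope_ldivP (c x u : Q) :
  isotope_mul x u = c <-> u = isotope_ldiv x c.
Proof.
unfold isotope_mul, isotope_ldiv; rewrite (ldivP L).
split; intro H; symmetry.
- now apply (ldivP L).
- now apply (ldivP L).
Qed.

Lemma isotope_rdivP (c y v : Q) :
  isotope_mul v y = c <-> v = isotope_rdiv c y.
Proof.
unfold isotope_mul, isotope_rdiv; rewrite (rdivP L).
split; intro H; symmetry.
- now apply (rdivP L).
- now apply (rdivP L).
Qed.

Lemma isotope_mul_1_l (x : Q) : isotope_mul isotope_one x = x.
Proof.
unfold isotope_mul, isotope_one.
rewrite <- (proj1 (rdivP L (b *[L] a) a b) eq_refl).
now apply (ldivP L).
Qed.

Lemma isotope_mul_1_r (x : Q) : isotope_mul x isotope_one = x.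
Proof.
unfold isotope_mul, isotope_one.
rewrite <- (proj1 (ldivP L (b *[L] a) b a) eq_refl).
now apply (rdivP L).
Qed.

Definition principal_isotope : loop Q := {|
  mul := isotope_mul;
  ldiv := isotope_ldiv;
  rdiv := isotope_rdiv;
  one := isotope_one;
  ldivP := fun c x u => isotope_ldivP c x u;
  rdivP := fun c y v => isotope_rdivP c y v;
  mul_1_l := isotope_mul_1_l;
  mul_1_r := isotope_mul_1_r
|}.

End PrincipalIsotope.

Section LoopPredicates.

Context {Q : Type} (L : loop Q).

Definition left_nucleus (x : Q) : Prop :=
  forall y z : Q, x *[L] (y *[L] z) = (x *[L] y) *[L] z.

Definition middle_nucleus (y : Q) : Prop :=
  forall x z : Q, x *[L] (y *[L] z) = (x *[L] y) *[L] z.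

Definition right_nucleus (z : Q) : Prop :=
  forall x y : Q, x *[L] (y *[L] z) = (x *[L] y) *[L] z.

Variable alpha : Q -> Q.

Definition generalized_Moufang_element (y : Q) : Prop :=
  forall x z : Q,
    ((x *[L] y) *[L] z) *[L] alpha y = x *[L] (y *[L] (z *[L] alpha y)).

Definition generalized_Moufang_loop : Prop :=
  forall x y z : Q,
    ((x *[L] y) *[L] z) *[L] alpha y = x *[L] (y *[L] (z *[L] alpha y)).

Definition elastic : Prop :=
  forall y z : Q,
    (y *[L] z) *[L] alpha y = y *[L] (z *[L] alpha y).

End LoopPredicates.

Definition universally_elastic {Q : Type} (L : loop Q) (alpha : Q -> Q) : Prop :=
  elastic L alpha /\
  forall a b : Q, elastic (principal_isotope L a b) alpha.

(* Main.v *)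
Require Import Defs.

(** Elasticity of every principal isotope amounts to one closure condition
    ([isotope_elastic_closure]): for factorizations [y = v a] and
    [alpha y = b c], five product equations force a sixth.  Everything about
    part (i) is read off from its cases [a = 1] and [b = 1].

    The Moufang identity at [y = 1] says that [alpha 1] lies in the right
    nucleus.  Elasticity at [y = 1] would therefore say nothing in the loop
    itself, but in the isotopes, after the factor [alpha 1] is cancelled, it
    says that [(b w) a = b (w a)] whenever [b a = 1]
    ([inverse_pair_associates]).

    If [alpha y] lies in the right nucleus, then [b a = 1] gives the
    factorization [alpha y = b (a (alpha y))], and the same cancellation at
    [y] leaves [(y w) a = y t], where [b t = (b w) a].  By the case [y = 1],
    [t = w a], so [y] associates with every pair [w], [a].  If instead [y]
    lies in the left nucleus, then [b a = 1] gives [y = (y b) a], the factor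
    [y] is cancelled, and the same identity shows that [alpha y] associates
    with every pair [b], [w].

    For part (ii), combining the Moufang identity at [y] with its instance
    [x = 1] gives [((x y) z) (alpha y) = x ((y z) (alpha y))].  Each of the two
    nuclear conditions turns this into the other one: one lets [x (y z)]
    replace [(x y) z], the other moves [alpha y] out on the right, and
    [y z] runs over the whole loop. *)

(** * Cancellation and division *)

Section LoopBasics.

Context {Q : Type} (L : loop Q).

Lemma mul_ldiv (b a : Q) : b *[L] ldiv L b a = a.
Proof. now apply (ldivP L). Qed.

Lemma mul_rdiv (a b : Q) : rdiv L a b *[L] b = a.
Proof. now apply (rdivP L). Qed.

Lemma ldiv_mul (b u : Q) : ldiv L b (b *[L] u) = u.
Proof. symmetry; now apply (ldivP L). Qed.

Lemma rdiv_mul (v b : Q) : rdiv L (v *[L] b) b = v.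
Proof. symmetry; now apply (rdivP L). Qed.

Lemma mul_cancel_l (b u v : Q) : b *[L] u = b *[L] v -> u = v.
Proof. intro H; rewrite <- (ldiv_mul b u), H; apply ldiv_mul. Qed.

Lemma mul_cancel_r (b u v : Q) : u *[L] b = v *[L] b -> u = v.
Proof. intro H; rewrite <- (rdiv_mul u b), H; apply rdiv_mul. Qed.

End LoopBasics.

(** * Universal elasticity and the outer nuclei *)

Section UniversalElasticity.

Context {Q : Type} (L : loop Q) (alpha : Q -> Q).

(** Elasticity of the isotope given by [a] and [b], at [y = v a] and
    [z = p a = b q]: the remaining hypotheses name the values of the divisions
    in the isotopic products, so that no quotient has to be simplified when
    the condition is used. *)
Lemma isotope_elastic_closure (a b v c p q r s : Q) :
  elastic (principal_isotope L a b) alpha ->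
  alpha (v *[L] a) = b *[L] c ->
  p *[L] a = b *[L] q ->
  v *[L] q = r *[L] a ->
  p *[L] c = b *[L] s ->
  r *[L] c = v *[L] s.
Proof.
intros E Hc Hq Hr Hs.
specialize (E (v *[L] a) (p *[L] a)); simpl in E; unfold isotope_mul in E.
rewrite Hc, !rdiv_mul, Hq, !ldiv_mul, Hr, rdiv_mul, Hs, ldiv_mul in E.
exact E.
Qed.

Hypothesis E : forall a b : Q, elastic (principal_isotope L a b) alpha.

(** The factorization [alpha y = b (a (alpha y))] makes [alpha y] a common
    right factor of both sides of the closure condition. *)
Lemma elastic_cancel_right_nuclear (y a b w t : Q) :
  right_nucleus L (alpha y) ->
  b *[L] a = one L -> b *[L] t = (b *[L] w) *[L] a ->
  (y *[L] w) *[L] a = y *[L] t.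
Proof.
intros N Hba Ht; apply (mul_cancel_r L (alpha y)).
rewrite <- !N.
apply (isotope_elastic_closure (one L) b _ _ (b *[L] w) w); auto.
- now rewrite mul_1_r, N, Hba, mul_1_l.
- now rewrite !mul_1_r.
- now rewrite mul_1_r.
- now rewrite !N, Ht.
Qed.

(** The factorization [y = (y b) a] makes [y] a common left factor of both
    sides of the closure condition. *)
Lemma elastic_cancel_left_nuclear (y a b w t : Q) :
  left_nucleus L y ->
  b *[L] a = one L -> t *[L] a = b *[L] (w *[L] a) ->
  t *[L] alpha y = b *[L] (w *[L] alpha y).
Proof.
intros N Hba Ht; apply (mul_cancel_l L y).
rewrite !N.
apply (isotope_elastic_closure a (one L) _ _ w (w *[L] a)); auto.
- now rewrite <- N, Hba, mul_1_r, mul_1_l.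
- now rewrite mul_1_l.
- now rewrite <- !N, Ht.
- now rewrite mul_1_l.
Qed.

Hypothesis N1 : right_nucleus L (alpha (one L)).

(** This is the case [y = 1] of the cancellation, where the unknown [t] is
    determined outright. *)
Lemma inverse_pair_associates (a b w : Q) :
  b *[L] a = one L -> (b *[L] w) *[L] a = b *[L] (w *[L] a).
Proof.
intro Hba.
pose proof (elastic_cancel_right_nuclear (one L) a b w _ N1 Hba
              (mul_ldiv L b _)) as H.
rewrite !mul_1_l in H.
now rewrite H, mul_ldiv.
Qed.

Lemma right_nucleus_alpha_iff_left_nucleus (y : Q) :
  right_nucleus L (alpha y) <-> left_nucleus L y.
Proof.
split; intro N.
- intros w a; symmetry.
  (* Every element [a] has a left inverse [b]. *)
  pose proof (mul_rdiv L (one L) a) as Hba.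
  apply (elastic_cancel_right_nuclear y a _ w _ N Hba).
  symmetry; now apply inverse_pair_associates.
- intros b w; symmetry.
  (* Every element [b] has a right inverse [a]. *)
  pose proof (mul_ldiv L b (one L)) as Hba.
  apply (elastic_cancel_left_nuclear y _ b w _ N Hba).
  now apply inverse_pair_associates.
Qed.

End UniversalElasticity.

(** * Generalized Moufang elements *)

Section MoufangElements.

Context {Q : Type} (L : loop Q) (alpha : Q -> Q).

Lemma Moufang_element_one :
  generalized_Moufang_element L alpha (one L) ->
  right_nucleus L (alpha (one L)).
Proof.
intros M x z; specialize (M x z).
now rewrite mul_1_r, mul_1_l in M.
Qed.

(** The instance [x = 1] is elasticity at [y], which brings both sides of the
    Moufang identity to the form of products ending in [alpha y]. *)
Lemma Moufang_element_elastic_form (y : Q) :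
  generalized_Moufang_element L alpha y ->
  forall x z : Q,
    ((x *[L] y) *[L] z) *[L] alpha y = x *[L] ((y *[L] z) *[L] alpha y).
Proof.
intros M x z; rewrite M.
pose proof (M (one L) z) as H; rewrite !mul_1_l in H.
now rewrite H.
Qed.

Lemma Moufang_element_middle_iff_right_nucleus (y : Q) :
  generalized_Moufang_element L alpha y ->
  (middle_nucleus L y <-> right_nucleus L (alpha y)).
Proof.
intro M; pose proof (Moufang_element_elastic_form y M) as F.
split; intros N x z.
- now rewrite <- (mul_ldiv L y z), <- F, N.
- apply (mul_cancel_r L (alpha y)).
  now rewrite F, N.
Qed.

End MoufangElements.

Theorem theorem3p2 (Q : Type) (L : loop Q) (alpha : Q -> Q)
    (alpha_onto : Surjective alpha)
    (L_Moufang : generalized_Moufang_loop L alpha)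
    (L_elastic : universally_elastic L alpha)
    (y : Q) :
  (right_nucleus L (alpha y) <-> left_nucleus L y) /\
  (generalized_Moufang_element L alpha y ->
     (middle_nucleus L y <-> right_nucleus L (alpha y))).
Proof.
split.
- apply right_nucleus_alpha_iff_left_nucleus.
  + exact (proj2 L_elastic).
  + apply Moufang_element_one; intros x z; apply L_Moufang.
- apply Moufang_element_middle_iff_right_nucleus.
Qed.
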